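(* Let $\mathbb K$ be an algebraically closed field of characteristic zero and $a\in\mathbb K$, $a\neq0$. Put $z(t)=t^3-a$, $x(t)=t\,z(t)=t^4-at$ and $y(t)=z(t)^2+\frac a2 z(t)$ in $\mathbb K[t]$. Let $f$ (respectively $g$) be the $y$-monic generator of the kernel of the $\mathbb K$-algebra map $\mathbb K[x,y]\to\mathbb K[t]$ sending $x\mapsto x(t)$, $y\mapsto y(t)$ (respectively $x\mapsto x(t)$, $y\mapsto z(t)$). Then $\mathbb K[x(t),y(t)]=\mathbb K[x(t),z(t)]$, $f=y^4-2x^3y^2+x^6-\frac12a^2y^3+\frac12a^2x^3y+\frac1{16}a^4x^3$ and $g=y^4+ay^3-x^3$. In particular, the $\mathbb K$-algebras $\mathbb K[x,y]/(f)$ and $\mathbb K[x,y]/(g)$ are isomorphic. However, $f$ is not equivalent to $g$. Hence a polynomial curve may have inequivalent embeddings in the affine plane.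
   Context: Two polynomials $f,g\in\mathbb K[x,y]$ are equivalent if $g=\sigma(f)$ for some $\mathbb K$-algebra automorphism $\sigma$ of $\mathbb K[x,y]$; they are isomorphic if $\mathbb K[x,y]/(f)\cong\mathbb K[x,y]/(g)$ as $\mathbb K$-algebras. The ''$y$-monic generator'' of a principal ideal is the generator that is monic as a polynomial in $y$ over $\mathbb K[x]$. A polynomial curve is a rational plane curve with one place at infinity, i.e. one parametrized by polynomials. *)

(* Defs.v *)
From HB Require Import structures.
From mathcomp Require Import all_boot all_algebra.
From mathcomp Require Import boolp.

Set Implicit Arguments.
Unset Strict Implicit.
Unset Printing Implicit Defensive.

Import GRing.Theory.
Local Open Scope ring_scope.
Local Open Scope quotient_scope.

(** * Quotient of a commutative ring by a principal ideal

    The quotients of [ring_quotient] are rings only for proper ideals; here the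
    generator is arbitrary, so the quotient is a possibly zero ring.  Classical
    logic makes membership in the ideal boolean. *)

Definition pideal (R : comPzRingType) (f : R) : {pred R} :=
  fun p => `[< exists q, p = q * f >].

Section PrincipalQuotient.
Variables (R : comPzRingType) (f : R).

Lemma pidealP p : reflect (exists q, p = q * f) (p \in pideal f).
Proof. exact: asboolP. Qed.

Lemma pideal_zmod_closed : zmod_closed (pideal f).
Proof.
split=> [|_ _ /pidealP[p ->] /pidealP[q ->]]; apply/pidealP.
  by exists 0; rewrite mul0r.
by exists (p - q); rewrite mulrBl.
Qed.

HB.instance Definition _ :=
  GRing.isZmodClosed.Build R (pideal f) pideal_zmod_closed.

Lemma pidealMl q p : p \in pideal f -> q * p \in pideal f.
Proof. by move=> /pidealP[r ->]; apply/pidealP; exists (q * r); rewrite mulrA. Qed.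

Definition pquot := {ideal_quot (pideal f)}.

HB.instance Definition _ := GRing.Zmodule.on pquot.
HB.instance Definition _ : EqQuotient R (Quotient.equiv (pideal f)) pquot :=
  EqQuotient.on pquot.

Definition pquot_pi (p : R) : pquot := \pi_pquot p.
Definition pquot_one : pquot := pquot_pi 1.
Definition pquot_mul (u v : pquot) : pquot := pquot_pi (repr u * repr v).

Lemma pquot_piP p q : pquot_pi p = pquot_pi q <-> p - q \in pideal f.
Proof.
have -> : (p - q \in pideal f) = (p == q %[mod pquot]) by exact: Quotient.idealrBE.
by split=> [e|/eqP//]; apply/eqP.
Qed.

Lemma pquot_reprK u : pquot_pi (repr u) = u.
Proof. exact: reprK. Qed.

Lemma pquot_piD p q : pquot_pi (p + q) = pquot_pi p + pquot_pi q.
Proof. exact: (@Quotient.pi_add R (pideal f)). Qed.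

Lemma pquot_piM p q : pquot_pi (p * q) = pquot_mul (pquot_pi p) (pquot_pi q).
Proof.
apply/pquot_piP; set p' := repr _; set q' := repr _.
have hp : p - p' \in pideal f by apply/pquot_piP; rewrite pquot_reprK.
have hq : q - q' \in pideal f by apply/pquot_piP; rewrite pquot_reprK.
have -> : p * q - p' * q' = q * (p - p') + p' * (q - q').
  by rewrite !mulrBr ![q * _]mulrC addrA subrK.
by rewrite rpredD ?pidealMl.
Qed.

Lemma pquot_mulA : associative pquot_mul.
Proof.
move=> u v w; rewrite -[u]pquot_reprK -[v]pquot_reprK -[w]pquot_reprK.
by rewrite -!pquot_piM mulrA.
Qed.

Lemma pquot_mulC : commutative pquot_mul.
Proof. by move=> u v; rewrite /pquot_mul mulrC. Qed.

Lemma pquot_mul1 : left_id pquot_one pquot_mul.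
Proof. by move=> u; rewrite -[u]pquot_reprK -pquot_piM mul1r. Qed.

Lemma pquot_mulDl : left_distributive pquot_mul +%R.
Proof.
move=> u v w; rewrite -[u]pquot_reprK -[v]pquot_reprK -[w]pquot_reprK.
by rewrite -pquot_piD -!pquot_piM -pquot_piD mulrDl.
Qed.

HB.instance Definition _ := GRing.Zmodule_isComPzRing.Build pquot
  pquot_mulA pquot_mulC pquot_mul1 pquot_mulDl.

End PrincipalQuotient.

(** * Plane curves

    K[x,y] is [{poly {poly K}}], that is K[x][y]: the outer variable is y, and
    being monic in y over K[x] is being monic. *)

Notation "{ 'polyXY' K }" := {poly {poly K}}
  (at level 0, format "{ 'polyXY'  K }") : type_scope.

Section PlaneCurves.
Variable K : fieldType.
Implicit Types (f g : {polyXY K}) (u v : {poly K}).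

Definition varX : {polyXY K} := 'X%:P.
Definition varY : {polyXY K} := 'X.
Definition constXY (c : K) : {polyXY K} := c%:P%:P.

(* The K-algebra map K[x,y] -> K[t] sending x to u and y to v. *)
Definition evXY u v (p : {polyXY K}) : {poly K} := (map_poly (comp_poly u) p).[v].

Definition in_subalg u v (p : {poly K}) : Prop := exists q, p = evXY u v q.

Definition kernel_generator u v f : Prop :=
  forall p, p \in pideal f <-> evXY u v p = 0.

Definition y_monic_kernel_generator u v f : Prop :=
  f \is monic /\ kernel_generator u v f.

(* A ring morphism is K-linear exactly when it fixes the constants. *)
Definition equivalent f g : Prop :=
  exists sigma : {rmorphism {polyXY K} -> {polyXY K}},
    [/\ forall c, sigma (constXY c) = constXY c, bijective sigma & g = sigma f].

Definition isomorphic f g : Prop :=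
  exists phi : {rmorphism pquot f -> pquot g},
    (forall c, phi (pquot_pi f (constXY c)) = pquot_pi g (constXY c)) /\
    bijective phi.

(* The curve f = 0 is parametrized by polynomials u, v: its ideal (f) is the
   ideal of all relations between them.  As such an ideal is prime and (f) is
   not maximal, f is irreducible and u, v are not both constant. *)
Definition polynomial_curve f : Prop := exists u v, kernel_generator u v f.

(* A plane curve determines its equation only up to a nonzero factor, so an
   automorphism of the plane carrying one curve to the other need only match
   their ideals. *)
Definition equivalent_curves f g : Prop :=
  exists2 h, pideal h =i pideal g & equivalent f h.

(* Embeddings in the plane of the curve with coordinate ring K[x,y]/(f) are
   recorded by the equations of their images. *)
Definition has_inequivalent_embeddings f : Prop :=
  exists g1 g2,
    [/\ isomorphic f g1, isomorphic f g2 & ~ equivalent_curves g1 g2].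

End PlaneCurves.

Section Parametrization.
Variables (K : fieldType) (a : K).

Definition zt : {poly K} := 'X^3 - a%:P.
Definition xt : {poly K} := 'X * zt.
Definition yt : {poly K} := zt ^+ 2 + (a / 2) *: zt.

End Parametrization.

(* Main.v *)
From HB Require Import structures.
Require Import Defs.
From mathcomp Require Import all_boot all_algebra.
From mathcomp Require Import ring.

(** With h = a/2 and w = y^2 - x^3 - h^2 y one has w(x(t), y(t)) = - h^3 z(t) and
    f = w^2 - h^4 w - h^6 y, so that y -> y^2 + h y and y -> - w / h^3 are inverse
    to each other modulo f and g.

    Inequivalence is detected at the critical points.  Both f and g have a D4
    point at the origin, on the fibre 0, and an A2 point on another fibre v.  An
    automorphism of the plane has a constant Jacobian j, so if it carries f to a
    multiple e g, then comparing at corresponding points the critical value v,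
    the discriminant of the cubic form at D4, and the product of the cube of the
    quadratic coefficient by the square of the transverse cubic coefficient at
    A2 gives three relations between e and j: they read e = h^4, j^6 = h^6 and
    j^6 = 4 h^6, which is absurd. *)

Set Implicit Arguments.
Unset Strict Implicit.
Unset Printing Implicit Defensive.

Import GRing.Theory.
Local Open Scope ring_scope.

(** * Evaluation of K[x,y] at a pair of polynomials in t *)

Section Evaluation.
Variable K : fieldType.
Implicit Types (u v : {poly K}) (p q f g : {polyXY K}).

HB.instance Definition _ u v := GRing.RMorphism.copy
  (evXY u v) (horner_eval v \o map_poly (comp_poly u)).

Lemma evXY_X u v : evXY u v (varX K) = u.
Proof. by rewrite /evXY map_polyC hornerC /= comp_polyX. Qed.

Lemma evXY_Y u v : evXY u v (varY K) = v.
Proof. by rewrite /evXY map_polyX hornerX. Qed.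

Lemma evXY_C u v (r : {poly K}) : evXY u v r%:P = r \Po u.
Proof. by rewrite /evXY map_polyC hornerC. Qed.

Lemma evXY_const u v c : evXY u v (constXY c) = c%:P.
Proof. by rewrite evXY_C comp_polyC. Qed.

Lemma evXYD u v p q : evXY u v (p + q) = evXY u v p + evXY u v q.
Proof. exact: rmorphD. Qed.

Lemma evXYB u v p q : evXY u v (p - q) = evXY u v p - evXY u v q.
Proof. exact: rmorphB. Qed.

Lemma evXYN u v p : evXY u v (- p) = - evXY u v p.
Proof. exact: rmorphN. Qed.

Lemma evXYM u v p q : evXY u v (p * q) = evXY u v p * evXY u v q.
Proof. exact: rmorphM. Qed.

Lemma evXYXn u v p n : evXY u v (p ^+ n) = evXY u v p ^+ n.
Proof. exact: rmorphXn. Qed.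

Definition evXYE :=
  (evXYB, evXYD, evXYN, evXYM, evXYXn, evXY_X, evXY_Y, evXY_const).

(** Composition in [{poly {poly K}}] substitutes for y and leaves x fixed. *)
Lemma evXY_comp u v q p : evXY u v (p \Po q) = evXY u (evXY u v q) p.
Proof. by rewrite /evXY map_comp_poly horner_comp. Qed.

Lemma horner_evXY u v p s : (evXY u v p).[s] = p.[(v.[s])%:P].[u.[s]].
Proof.
elim/poly_ind: p => [|p c IH]; first by rewrite rmorph0 !horner0.
by rewrite rmorphD rmorphM /= evXY_C evXY_Y !hornerE IH horner_comp.
Qed.

End Evaluation.

(** * Generators of principal ideals, and isomorphisms of quotients *)

Section PrincipalIdeals.
Variable K : fieldType.
Implicit Types (u v : {poly K}) (p q f g : {polyXY K}).

Lemma unit_polyXY p : p \is a GRing.unit -> exists2 c, c != 0 & p = constXY c.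
Proof.
rewrite !poly_unitE => /andP[/eqP sp /andP[/eqP sp0]].
rewrite unitfE => c0; exists p`_0`_0 => //.
by rewrite /constXY -(size1_polyC (eq_leq sp0)) -(size1_polyC (eq_leq sp)).
Qed.

Lemma pideal_refl f : f \in pideal f.
Proof. by apply/pidealP; exists 1; rewrite mul1r. Qed.

(** For g nonzero the two cofactors are mutually inverse, hence constants; for g = 0 both generators
    vanish. *)
Lemma eq_pideal_const f g :
  pideal f =i pideal g -> exists2 c, c != 0 & f = constXY c * g.
Proof.
move=> fg; have /pidealP[q fE] : f \in pideal g by rewrite -fg pideal_refl.
have /pidealP[r gE] : g \in pideal f by rewrite fg pideal_refl.
have [g0|g0] := eqVneq g 0.
  by exists 1; rewrite ?oner_eq0 // fE g0 !mulr0.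
have [|c c0 qE] := @unit_polyXY q; last by exists c; rewrite // -qE.
apply/unitrPr; exists r; apply: (mulIf g0).
by rewrite mul1r {2}gE fE; ring.
Qed.

Lemma y_monic_kernel_generator_uniq u v f g :
  y_monic_kernel_generator u v f -> y_monic_kernel_generator u v g -> f = g.
Proof.
move=> [mf kf] [mg kg]; have [|c c0 fE] := @eq_pideal_const f g.
  by move=> p; apply/idP/idP => /[dup] _; [move/kf/kg | move/kg/kf].
move: mf; rewrite fE monicE lead_coef_Mmonic // lead_coefC /constXY => /eqP ->.
by rewrite mul1r.
Qed.

(* The quotients are identified with the images of the evaluations. *)
Lemma isomorphic_of_substitution u v u' v' f g
    (A B : {rmorphism {polyXY K} -> {polyXY K}}) :
  kernel_generator u v f -> kernel_generator u' v' g ->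
  (forall c, A (constXY c) = constXY c) ->
  (forall p, evXY u v p = evXY u' v' (A p)) ->
  (forall p, evXY u' v' p = evXY u v (B p)) -> isomorphic f g.
Proof.
move=> kf kg Ac eA eB.
have fP p q : pquot_pi f p = pquot_pi f q <-> evXY u v p = evXY u v q.
  rewrite pquot_piP kf evXYB; split=> [/eqP|->]; last exact: subrr.
  by rewrite subr_eq0 => /eqP.
have gP p q : pquot_pi g p = pquot_pi g q <-> evXY u' v' p = evXY u' v' q.
  rewrite pquot_piP kg evXYB; split=> [/eqP|->]; last exact: subrr.
  by rewrite subr_eq0 => /eqP.
pose phi (w : pquot f) := pquot_pi g (A (repr w)).
(* The representative does not matter, since A respects equality of evaluations. *)
have phiE p : phi (pquot_pi f p) = pquot_pi g (A p).
  by apply/gP; rewrite -!eA; apply/fP; rewrite pquot_reprK.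
have phi_add : zmod_morphism phi.
  move=> w1 w2; rewrite -[w1]pquot_reprK -[w2]pquot_reprK.
  have piB h p q : pquot_pi h (p - q) = pquot_pi h p - pquot_pi h q.
    by apply: (addIr (pquot_pi h q)); rewrite -pquot_piD !subrK.
  by rewrite -piB !phiE rmorphB piB.
have phi_mul : monoid_morphism phi.
  split=> [|w1 w2]; first by rewrite [LHS]phiE rmorph1.
  rewrite -[w1]pquot_reprK -[w2]pquot_reprK.
  have piM h p q : pquot_pi h (p * q) = pquot_pi h p * pquot_pi h q.
    exact: pquot_piM.
  by rewrite -piM !phiE rmorphM piM.
pose phi_a := GRing.isZmodMorphism.Build _ _ phi phi_add.
pose phi_m := GRing.isMonoidMorphism.Build _ _ phi phi_mul.
pose phiR : {rmorphism pquot f -> pquot g} := HB.pack phi phi_a phi_m.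
exists phiR; split=> [c|]; first by rewrite [LHS]phiE Ac.
exists (fun w => pquot_pi f (B (repr w))) => w.
  rewrite -[w]pquot_reprK [phiR _]phiE; apply/fP.
  by rewrite -eB -[RHS]/(evXY u v (repr w)) eA; apply/gP; rewrite !pquot_reprK.
rewrite [LHS]phiE -{2}[w]pquot_reprK; apply/gP.
by rewrite -eA -eB.
Qed.

End PrincipalIdeals.

(** The leading term of the largest nonzero summand has nothing to cancel with. *)
Lemma sum_neq_sizes (R : nzRingType) (I : finType) (T : I -> {poly R}) :
    (forall i j, T i != 0 -> size (T i) = size (T j) -> i = j) ->
  \sum_i T i = 0 -> forall i, T i = 0.
Proof.
move=> inj sT0 i0; apply/eqP; apply: contraT => Ti0.
case: (@arg_maxnP _ i0 xpredT (size \o T) isT) => i _ /= imax.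
have Ti : T i != 0.
  by rewrite -size_poly_gt0 (leq_trans _ (imax i0 isT)) // size_poly_gt0.
have := congr1 (coefp (size (T i)).-1) sT0.
rewrite /= coef_sum coef0 (bigD1 i) //= big1 ?addr0 => [|j ji].
  by rewrite -lead_coefE => /eqP; rewrite lead_coef_eq0 (negPf Ti).
apply: nth_default; rewrite -ltnS prednK ?size_poly_gt0 // ltn_neqAle imax //.
by rewrite andbT; apply: contraNneq ji => eij; apply/eqP/esym/inj.
Qed.

Lemma monic_MXaddC (R : nzRingType) (p : {poly R}) r :
  p \is monic -> p * 'X + r%:P \is monic.
Proof.
move=> mp; rewrite monicE lead_coefDl ?lead_coefMX -?monicE //.
by rewrite size_mulX ?monic_neq0 // ltnS (leq_trans (size_polyC_leq1 _)) //
  size_poly_gt0 monic_neq0.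
Qed.

(** Modulo f, r is y, so substituting r for y changes nothing; the induction follows Horner's
    scheme. *)
Lemma comp_poly_pideal (K : fieldType) (f r p : {polyXY K}) :
  r - 'X \in pideal f -> p \Po r - p \in pideal f.
Proof.
move=> rX; elim/poly_ind: p => [|p e IH]; first by rewrite comp_poly0 subr0 rpred0.
have -> : (p * 'X + e%:P) \Po r - (p * 'X + e%:P) =
    r * (p \Po r - p) + p * (r - 'X).
  by rewrite comp_polyD comp_polyM comp_polyX comp_polyC; ring.
by rewrite rpredD // pidealMl.
Qed.

(** * The kernels generated by f and g, and the isomorphism of the quotients *)

Section Curves.
Variables (K : fieldType) (a h : K).
Hypothesis ah : a = h + h.
Local Notation x := (varX K).
Local Notation y := (varY K).
Local Notation c := (@constXY K).

Definition quartic : {polyXY K} := y ^+ 4 + c a * y ^+ 3 - x ^+ 3.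
Definition wXY : {polyXY K} := y ^+ 2 - x ^+ 3 - c (h ^+ 2) * y.
(** Putting z = - w / h^3 into y = z^2 + h z and clearing h^6 yields this form of f. *)
Definition sextic : {polyXY K} :=
  wXY ^+ 2 - c (h ^+ 4) * wXY - c (h ^+ 6) * y.

(** In Horner form, monicity and degree in y follow one factor at a time. *)
Lemma quarticE : quartic = ((('X + (a%:P)%:P) * 'X + 0%:P) * 'X + 0%:P) * 'X
    + (- 'X ^+ 3)%:P.
Proof.
by rewrite /quartic /varX /varY /constXY polyC0 polyCN rmorphXn /=; ring.
Qed.

Lemma quartic_monic : quartic \is monic.
Proof.
rewrite quarticE.
by do 3!apply: monic_MXaddC; apply: monicXaddC.
Qed.

Lemma size_quartic : size quartic = 5.
Proof.
have size_monic (p : {polyXY K}) r :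
    p \is monic -> size (p * 'X + r%:P) = (size p).+1.
  by move=> /monic_neq0 p0; rewrite size_MXaddC (negPf p0).
rewrite quarticE !size_monic ?size_XaddC //;
  by do ?apply: monic_MXaddC; apply: monicXaddC.
Qed.

Lemma sextic_monic : sextic \is monic.
Proof.
have -> : sextic = ((('X + (- (h ^+ 2) *+ 2)%:P%:P) * 'X
   + (- 'X^3 *+2)%:P) * 'X + ('X^3 * (h ^+ 2)%:P *+ 2)%:P) * 'X
    + ('X ^+ 6 + (h ^+ 4)%:P * 'X^3)%:P.
  rewrite /sextic /wXY /varX /varY /constXY.
  by rewrite !(polyCN, polyCD, polyCM, rmorphXn, rmorphMn) /=; ring.
by do 3!apply: monic_MXaddC; apply: monicXaddC.
Qed.

Lemma size_zt : size (zt a) = 4.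
Proof. by rewrite /zt size_XnsubC. Qed.

Lemma size_xt : size (xt a) = 5.
Proof. by rewrite /xt mulrC size_mulX ?size_zt // -size_poly_eq0 size_zt. Qed.

Lemma evXY_quartic : evXY (xt a) (zt a) quartic = 0.
Proof.
rewrite /quartic !evXYE.
by rewrite /xt /zt; ring.
Qed.

(* Since x(t) has degree 4 and z(t) degree 3, the terms r_j(x(t)) z(t)^j with
   j < 4 have degrees that are distinct modulo 4. *)
Lemma evXY_size4_eq0 (r : {polyXY K}) :
  (size r <= 4)%N -> evXY (xt a) (zt a) r = 0 -> r = 0.
Proof.
move=> sr; pose T (j : 'I_4) := (r`_j \Po xt a) * zt a ^+ j.
have -> : evXY (xt a) (zt a) r = \sum_j T j.
  rewrite /evXY (@horner_coef_wide _ 4) ?(leq_trans (size_poly _ _)) //.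
  by apply: eq_bigr => j _; rewrite coef_map.
have z0 : zt a != 0 by rewrite -size_poly_eq0 size_zt.
have szT j : T j != 0 -> size (T j) = ((size r`_j).-1 * 4 + 3 * j).+1.
  rewrite /T mulf_eq0 negb_or => /andP[rj0 zj0].
  rewrite size_mul // -[size (polyseq (_ \Po _))]prednK ?size_poly_gt0 //.
  rewrite size_comp_poly size_xt -[size (polyseq (_ ^+ _))]prednK ?size_poly_gt0 //.
  by rewrite size_exp size_zt addSn addnS /= mulnC.
move=> /sum_neq_sizes H; apply/polyP => i; rewrite coef0.
have [i4|i4] := ltnP i 4; last by rewrite nth_default // (leq_trans sr).
have /eqP : T (Ordinal i4) = 0.
  apply: H => j k Tj e; have Tk : T k != 0.
    by rewrite -size_poly_gt0 -e size_poly_gt0.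
  (* Modulo 4 only 3j is left of the degree, and 3 is invertible modulo 4. *)
  move: e; rewrite !szT // => -[/(congr1 (modn^~ 4))].
  rewrite !modnMDl => e; apply: val_inj; move: e.
  by case: j {Tj} => [[|[|[|[|?]]]] ?]; case: k {Tk} => [[|[|[|[|?]]]] ?].
rewrite /T mulf_eq0 expf_eq0 (negPf z0) andbF orbF.
by rewrite comp_poly_eq0 ?size_xt // => /eqP.
Qed.

(** Division by the monic g leaves a remainder of degree at most 3 in y; it also evaluates to 0,
    hence is 0. *)
Lemma quartic_kernel : kernel_generator (xt a) (zt a) quartic.
Proof.
move=> p; split=> [/pidealP[q ->]|p0].
  by rewrite evXYM evXY_quartic mulr0.
have := Pdiv.RingMonic.rdivp_eq quartic_monic p.
set q := Pdiv.CommonRing.rdivp _ _; set r := Pdiv.CommonRing.rmodp _ _ => pE.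
apply/pidealP; exists q; rewrite pE -[RHS]addr0; congr (_ + _).
apply: evXY_size4_eq0.
  by have := Pdiv.Ring.ltn_rmodpN0 p (monic_neq0 quartic_monic); rewrite size_quartic.
by move: p0; rewrite pE evXYD evXYM evXY_quartic mulr0 add0r.
Qed.

Hypothesis h0 : h != 0.
Local Notation yh := (zt a ^+ 2 + h *: zt a).

(* The substitutions y -> y^2 + h y and y -> - w / h^3 induce the two inclusions
   between the subalgebras generated by x(t), y(t) and by x(t), z(t). *)
Definition to_z : {polyXY K} := y ^+ 2 + c h * y.
Definition to_y : {polyXY K} := - (c (h ^- 3) * wXY).

Lemma evXY_to_z : evXY (xt a) (zt a) to_z = yh.
Proof.
rewrite /to_z !evXYE.
by rewrite mul_polyC.
Qed.

(** Since t^3 = z + a, x^3 = z^4 + 2h z^3 cancels the top terms of y^2, and h^2 y removes h^2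
    z^2. *)
Lemma evXY_wXY : evXY (xt a) yh wXY = - (h ^+ 3)%:P * zt a.
Proof.
rewrite /wXY !evXYE -mul_polyC.
by rewrite /xt /zt ah; ring.
Qed.

Lemma evXY_to_y : evXY (xt a) yh to_y = zt a.
Proof.
rewrite /to_y evXYN evXYM evXY_wXY evXY_const mulrA mulrN mulNr opprK.
by rewrite -polyCM mulVf ?expf_neq0 // mul1r.
Qed.

Lemma evXY_sextic : evXY (xt a) yh sextic = 0.
Proof.
rewrite /sextic; move: wXY evXY_wXY => w wE.
by rewrite !evXYE wE -mul_polyC !polyC_exp; ring.
Qed.

Lemma evXY_comp_to_z p : evXY (xt a) yh p = evXY (xt a) (zt a) (p \Po to_z).
Proof. by rewrite evXY_comp evXY_to_z. Qed.

Lemma evXY_comp_to_y p : evXY (xt a) (zt a) p = evXY (xt a) yh (p \Po to_y).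
Proof. by rewrite evXY_comp evXY_to_y. Qed.

Let const_hK : c h * c h^-1 = 1.
Proof. by rewrite -!polyCM divff. Qed.

Let comp_polyX_exp (q p : {polyXY K}) n : (p ^+ n) \Po q = (p \Po q) ^+ n.
Proof. exact: rmorphXn. Qed.

Let compE := (comp_polyB, comp_polyD, comp_polyM, comp_polyX_exp,
  @comp_polyC {poly K}, comp_polyX).

Lemma to_z_to_y : to_z \Po to_y - y = c h^-1 ^+ 6 * sextic.
Proof.
rewrite /to_z !compE /to_y /sextic -[h ^- 3]exprVn /constXY !polyC_exp.
rewrite -!/(constXY _).
by move: const_hK; set H := c h; set k := c _ => Hk; ring: Hk.
Qed.

Lemma quartic_to_y : quartic \Po to_y \in pideal sextic.
Proof.
(* Let z be [to_y] and Y = z^2 + h z, so that Y - y = h^-6 [sextic]. As x^3 = y^2 - h^2 y + h^3 z,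
   the quartic at z is (Y - y)(Y + y - h^2). *)
apply/pidealP; exists (c h^-1 ^+ 6 *
  (2 * y + c h^-1 ^+ 6 * sextic - c h ^+ 2)).
rewrite /quartic !compE /to_y /sextic /wXY -[h ^- 3]exprVn ah /constXY.
rewrite !polyCD !polyC_exp -!/(constXY _).
by move: const_hK; set H := c h; set k := c _ => Hk; ring: Hk.
Qed.

(** The kernel of g is transported: [to_z] sends a relation p to a multiple of g, [to_y] sends that
    to a multiple of f, and the round trip is the identity modulo f. *)
Lemma sextic_kernel : kernel_generator (xt a) yh sextic.
Proof.
move=> p; split=> [/pidealP[q ->]|p0].
  by rewrite evXYM evXY_sextic mulr0.
have /pidealP[q pq] : p \Po to_z \in pideal quartic.
  by apply/quartic_kernel; rewrite -evXY_comp_to_z.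
rewrite -(subKr (p \Po to_z \Po to_y) p) rpredB //.
  by rewrite pq comp_polyM pidealMl // quartic_to_y.
by rewrite -comp_polyA comp_poly_pideal // to_z_to_y pidealMl // pideal_refl.
Qed.

Lemma sextic_quartic_isomorphic : isomorphic sextic quartic.
Proof.
apply: (@isomorphic_of_substitution _ _ _ _ _ _ _ (comp_poly to_z) (comp_poly to_y)
  sextic_kernel quartic_kernel).
- by move=> e; rewrite /= comp_polyC.
- exact: evXY_comp_to_z.
- exact: evXY_comp_to_y.
Qed.

End Curves.

(** * The chain rule for derivations *)

Section ChainRule.
Variables (K : fieldType) (B : comNzRingType).
Variables (phi : {rmorphism {polyXY K} -> B}) (D : {additive B -> B}).
Hypothesis DM : forall u v, D (u * v) = D u * v + u * D v.
Hypothesis D_const : forall c, D (phi (constXY c)) = 0.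

(** Both sides are derivations along [phi] that agree on constants, x and y. The target is arbitrary
    in order to cover the partial derivatives after an automorphism as well as d/dt along a line. *)
Lemma chain_rule p :
  D (phi p) = phi (map_poly (@deriv _) p) * D (phi (varX K))
              + phi p^`() * D (phi (varY K)).
Proof.
have chain_X (r : {poly K}) : D (phi r%:P) = phi r^`()%:P * D (phi (varX K)).
  elim/poly_ind: r => [|r c IH].
    by rewrite deriv0 polyC0 !rmorph0 raddf0 mul0r.
  rewrite derivD derivM derivX derivC mulr1 addr0.
  rewrite !polyCD !polyCM !rmorphD !rmorphM /= raddfD DM IH D_const.
  by rewrite -/(varX K); ring.
elim/poly_ind: p => [|p r IH].
  by rewrite deriv0 !rmorph0 raddf0 raddf0 !rmorph0 !mul0r addr0.
have -> : map_poly (@deriv _) (p * 'X + r%:P) =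
    map_poly (@deriv _) p * 'X + r^`()%:P.
  apply/polyP => i; rewrite !(coef_map, coefD, coefMX, coefC) /=.
  by case: i => [|i]; rewrite !(derivD, deriv0).
rewrite derivD derivM derivX derivC mulr1 addr0.
rewrite !rmorphD !rmorphM /= raddfD DM IH (chain_X r) -/(varY K).
by ring.
Qed.

End ChainRule.

(** * The Jacobian of an automorphism of the plane *)

Section Jacobian.
Variable K : fieldType.
Local Notation dX := (map_poly (@deriv K)).

(** [dX], acting on the coefficients, is the partial derivative in x; [deriv] is the one in y. *)
Definition jacobian (p q : {polyXY K}) := dX p * q^`() - p^`() * dX q.

Lemma dXM p q : dX (p * q) = dX p * q + p * dX q.
Proof.
apply/polyP => i; rewrite coefD !coefM coef_map coefM raddf_sum -big_split /=.
by apply: eq_bigr => j _; rewrite !coef_map derivM.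
Qed.

Lemma dX_X : dX (varX K) = 1.
Proof. by rewrite map_polyC /= derivX. Qed.

Lemma dX_Y : dX (varY K) = 0.
Proof.
apply/polyP => i; rewrite coef_map coefX coef0 /=.
by case: eqP; rewrite ?derivC ?deriv0.
Qed.

(** By the chain rule for s(t(x)) = x and s(t(y)) = y, the Jacobian of s has as inverse the image
    under s of that of t; units are nonzero constants. *)
Lemma jacobian_automorphism (s : {rmorphism {polyXY K} -> {polyXY K}}) :
    (forall c, s (constXY c) = constXY c) -> bijective s ->
  exists2 j, j != 0 & jacobian (s (varX K)) (s (varY K)) = constXY j.
Proof.
move=> sc [t ts st].
have ruleX p : dX (s p) = s (dX p) * dX (s (varX K)) + s p^`() * dX (s (varY K)).
  apply: (@chain_rule K _ s (map_poly (@deriv K))) => [u v|c]; first exact: dXM.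
  by rewrite /= sc map_polyC /= derivC.
have ruleY p : (s p)^`() =
    s (dX p) * (s (varX K))^`() + s p^`() * (s (varY K))^`().
  apply: (@chain_rule K _ s (@deriv _)) => [u v|c]; first exact: derivM.
  by rewrite /= sc derivC.
apply: unit_polyXY; apply/unitrPr.
exists (s (jacobian (t (varX K)) (t (varY K)))).
have := ruleX (t (varX K)); have := ruleY (t (varX K)).
have := ruleX (t (varY K)); have := ruleY (t (varY K)).
rewrite !st dX_X dX_Y derivX derivC.
rewrite /jacobian !rmorphB !rmorphM /= => e1 e2 e3 e4.
have -> : (1 : {polyXY K}) = 1 * 1 - 0 * 0 by ring.
by rewrite {1}e4 e1 {1}e3 e2; ring.
Qed.

End Jacobian.

(** * Taylor coefficients along lines *)

Section Restriction.
Variable K : fieldType.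
Implicit Types (p q u w : {poly K}) (r : {polyXY K}) (x y v a h : K).
Local Notation dX := (map_poly (@deriv K)).

(** Coefficients along all lines through a point replace its higher partial derivatives. *)
Definition line_res x0 y0 v1 v2 r : {poly K} :=
  evXY (x0%:P + v1 *: 'X) (y0%:P + v2 *: 'X) r.

Lemma line_res0 x0 y0 v1 v2 r : (line_res x0 y0 v1 v2 r)`_0 = r.[y0%:P].[x0].
Proof. by rewrite -horner_coef0 horner_evXY !hornerE. Qed.

Lemma line_res1 x0 y0 v1 v2 r : (line_res x0 y0 v1 v2 r)`_1 =
  (dX r).[y0%:P].[x0] * v1 + r^`().[y0%:P].[x0] * v2.
Proof.
rewrite -[LHS]mulr1n -(coef_deriv _ 0) /line_res.
rewrite (@chain_rule K _ (evXY _ _) (@deriv _)); first last.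
- by move=> c; rewrite /= evXY_const derivC.
- exact: derivM.
rewrite /= evXY_X evXY_Y !derivD !derivC !derivZ derivX !add0r !alg_polyC.
by rewrite coefD !coefMC -!horner_coef0 !horner_evXY !hornerE.
Qed.

Lemma coefM_low p q : ((p * q)`_0 = p`_0 * q`_0) *
  ((p * q)`_1 = p`_0 * q`_1 + p`_1 * q`_0) *
  ((p * q)`_2 = p`_0 * q`_2 + p`_1 * q`_1 + p`_2 * q`_0) *
  ((p * q)`_3 = p`_0 * q`_3 + p`_1 * q`_2 + p`_2 * q`_1 + p`_3 * q`_0).
Proof. by rewrite !coefM !big_ord_recr !big_ord0 /= !add0r. Qed.

(** The outer quadratic polynomial is expanded in terms of the coefficients [W0] to [W3] of the
    inner one; u and w stand for the images of x and y along a line. *)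
Lemma sextic_low_coefs h u w :
  let W := w ^+ 2 - u ^+ 3 - (h ^+ 2)%:P * w in
  let F := W ^+ 2 - (h ^+ 4)%:P * W - (h ^+ 6)%:P * w in
  let W0 := w`_0 ^+ 2 - u`_0 ^+ 3 - h ^+ 2 * w`_0 in
  let W1 := w`_0 * w`_1 *+ 2 - u`_0 ^+ 2 * u`_1 *+ 3 - h ^+ 2 * w`_1 in
  let W2 := w`_0 * w`_2 *+ 2 + w`_1 ^+ 2
    - (u`_0 * u`_1 ^+ 2 + u`_0 ^+ 2 * u`_2) *+ 3 - h ^+ 2 * w`_2 in
  let W3 := (w`_0 * w`_3 + w`_1 * w`_2) *+ 2
    - (u`_1 ^+ 3 + u`_0 * u`_1 * u`_2 *+ 6 + u`_0 ^+ 2 * u`_3 *+ 3)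
    - h ^+ 2 * w`_3 in
  [/\ F`_0 = W0 ^+ 2 - h ^+ 4 * W0 - h ^+ 6 * w`_0,
      F`_1 = W0 * W1 *+ 2 - h ^+ 4 * W1 - h ^+ 6 * w`_1,
      F`_2 = W0 * W2 *+ 2 + W1 ^+ 2 - h ^+ 4 * W2 - h ^+ 6 * w`_2 &
      F`_3 = (W0 * W3 + W1 * W2) *+ 2 - h ^+ 4 * W3 - h ^+ 6 * w`_3].
Proof.
move=> W F W0 W1 W2 W3.
have WE : [/\ W`_0 = W0, W`_1 = W1, W`_2 = W2 & W`_3 = W3].
  by rewrite /W /W0 /W1 /W2 /W3 !exprS !expr0 !mulr1
     !(coefB, coefCM, coefM_low); split; ring.
case: WE; rewrite /F; move: W W0 W1 W2 W3 {F} => W W0 W1 W2 W3 e0 e1 e2 e3.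
rewrite [W ^+ 2]expr2 !(coefB, coefCM, coefM_low) e0 e1 e2 e3.
by split; ring.
Qed.

(** The base point has x = 0 because the x-derivative of g is - 3 x^2. *)
Lemma quartic_low_coefs a y0 v1 v2 :
  let y : {poly K} := y0%:P + v2 *: 'X in
  let G := y ^+ 4 + a%:P * y ^+ 3 - (0%:P + v1 *: 'X) ^+ 3 in
  [/\ G`_0 = y0 ^+ 4 + a * y0 ^+ 3,
      G`_1 = (y0 ^+ 3 *+ 4 + a * y0 ^+ 2 *+ 3) * v2,
      G`_2 = (y0 ^+ 2 *+ 6 + a * y0 *+ 3) * v2 ^+ 2 &
      G`_3 = (y0 *+ 4 + a) * v2 ^+ 3 - v1 ^+ 3].
Proof.
have lineE (e v : K) : let l : {poly K} := e%:P + v *: 'X in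
    [/\ l`_0 = e, l`_1 = v, l`_2 = 0 & l`_3 = 0].
  by rewrite /= !coefD !coefZ !coefX !coefC /= !(mulr0, mulr1, addr0, add0r).
move=> y; have [] := lineE y0 v2; have [] := lineE 0 v1.
rewrite -/y; move: (_ + v1 *: 'X) y => x y x0 x1 x2 x3 yE0 yE1 yE2 yE3 /=.
rewrite !exprS !expr0 !mulr1 !(coefB, coefD, coefCM, coefM_low).
by rewrite x0 x1 x2 x3 yE0 yE1 yE2 yE3; split; ring.
Qed.

End Restriction.

(** * Comparison of the critical points of f and g *)

Section Invariants.
Variables (K : fieldType) (h : K).
Hypotheses (h0 : h != 0) (two0 : 2 != 0 :> K) (three0 : 3 != 0 :> K).

Let sixteen0 : 16 != 0 :> K.
Proof. by rewrite (_ : 16 = (2 * 2) * (2 * 2)) ?mulf_neq0 //; ring. Qed.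

(** Directions map invertibly, so Cramer's rule makes the whole gradient of f vanish. The
    y-derivative forces 2 [W0] - h^4 to be nonzero, the x-derivative then gives u0 = 0, and a cubic
    equation for w0 remains. *)
Lemma sextic_critical_point (u0 w0 l1 l2 m1 m2 : K) :
    l1 * m2 - l2 * m1 != 0 ->
    (forall v1 v2, let W0 := w0 ^+ 2 - u0 ^+ 3 - h ^+ 2 * w0 in
      let u1 := l1 * v1 + l2 * v2 in let w1 := m1 * v1 + m2 * v2 in
      let W1 := w0 * w1 *+ 2 - u0 ^+ 2 * u1 *+ 3 - h ^+ 2 * w1 in
      W0 * W1 *+ 2 - h ^+ 4 * W1 - h ^+ 6 * w1 = 0) ->
  u0 = 0 /\ (w0 = 0 \/ w0 = 3 / 2 * h ^+ 2).
Proof.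
move=> j0 /= F1.
set W0 := w0 ^+ 2 - u0 ^+ 3 - h ^+ 2 * w0 in F1.
(* A and B are the partial derivatives of f in x and y at (u0, w0). *)
pose A := - 3 * u0 ^+ 2 * (2 * W0 - h ^+ 4).
pose B := (2 * W0 - h ^+ 4) * (2 * w0 - h ^+ 2) - h ^+ 6.
have AB1 : A * l1 + B * m1 = 0 by rewrite -(F1 1 0) /A /B; ring.
have AB2 : A * l2 + B * m2 = 0 by rewrite -(F1 0 1) /A /B; ring.
have A0 : A = 0.
  apply: (mulIf j0); rewrite mul0r.
  have -> : A * (l1 * m2 - l2 * m1) =
    (A * l1 + B * m1) * m2 - (A * l2 + B * m2) * m1 by ring.
  by rewrite AB1 AB2 !mul0r subr0.
have B0 : B = 0.
  apply: (mulIf j0); rewrite mul0r.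
  have -> : B * (l1 * m2 - l2 * m1) =
    (A * l2 + B * m2) * l1 - (A * l1 + B * m1) * l2 by ring.
  by rewrite AB1 AB2 !mul0r subr0.
have W0h : 2 * W0 - h ^+ 4 != 0.
  apply: contraNneq (expf_neq0 6 h0) => W0h; move: B0.
  by rewrite /B W0h mul0r sub0r => /eqP; rewrite oppr_eq0.
have u00 : u0 = 0.
  move/eqP: A0; rewrite /A !(expf_eq0, mulf_eq0) oppr_eq0 (negPf three0) (negPf W0h).
  by rewrite orbF => /eqP.
split=> //; have /eqP : 2 * w0 ^+ 2 * (2 * w0 - 3 * h ^+ 2) = 0.
  by rewrite -B0 /B /W0 u00; ring.
rewrite !(expf_eq0, mulf_eq0) (negPf two0) /= => /orP[/eqP|]; first by left.
by rewrite subr_eq0 => /eqP w03; right; rewrite mulrAC -w03; field.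
Qed.

(* The restriction to lines of an identity between cubic forms; taking the
   discriminant of both sides gives the conclusion. *)
Lemma D4_invariant (e l1 l2 m1 m2 : K) :
    l1 * m2 - l2 * m1 != 0 ->
    (forall v1 v2 : K, - 2 * h ^+ 2 * (m1 * v1 + m2 * v2) ^+ 3
      + h ^+ 4 * (l1 * v1 + l2 * v2) ^+ 3 = e * (2 * h * v2 ^+ 3 - v1 ^+ 3)) ->
  h ^+ 10 * (l1 * m2 - l2 * m1) ^+ 6 = e ^+ 4.
Proof.
move=> j0 F3; set j := l1 * m2 - l2 * m1 in j0 *.
have F30 := F3 1 0; have F03 := F3 0 1.
have six0 : 6 != 0 :> K.
  by rewrite (_ : 6 = 2 * 3 :> K) ?mulf_neq0 //; ring.
have h20 : h ^+ 2 != 0 by rewrite expf_neq0.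
(* Values of [f] at (1, 1), (1, -1), (1, 0) and (0, 1) isolate its mixed coefficients, to which the
   right-hand form contributes nothing. *)
pose f v1 v2 := - 2 * h ^+ 2 * (m1 * v1 + m2 * v2) ^+ 3
  + h ^+ 4 * (l1 * v1 + l2 * v2) ^+ 3 - e * (2 * h * v2 ^+ 3 - v1 ^+ 3).
have f0 v1 v2 : f v1 v2 = 0 by rewrite /f F3 subrr.
have F21 : h ^+ 2 * l1 ^+ 2 * l2 - 2 * m1 ^+ 2 * m2 = 0.
  apply: (mulfI h20); apply: (mulfI six0); rewrite !mulr0.
  transitivity (f 1 1 - f 1 (-1) - 2 * f 0 1); first by rewrite /f; ring.
  by rewrite !f0 mulr0 !subr0.
have F12 : h ^+ 2 * l1 * l2 ^+ 2 - 2 * m1 * m2 ^+ 2 = 0.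
  apply: (mulfI h20); apply: (mulfI six0); rewrite !mulr0.
  transitivity (f 1 1 + f 1 (-1) - 2 * f 1 0); first by rewrite /f; ring.
  by rewrite !f0 mulr0 subr0 addr0.
have /eqP : 2 * (m1 * m2) * j = 0.
  transitivity ((h ^+ 2 * l1 ^+ 2 * l2 - 2 * m1 ^+ 2 * m2) * l2
    - (h ^+ 2 * l1 * l2 ^+ 2 - 2 * m1 * m2 ^+ 2) * l1); first by rewrite /j; ring.
  by rewrite F21 F12; ring.
have /eqP : h ^+ 2 * (l1 * l2) * j = 0.
  transitivity ((h ^+ 2 * l1 ^+ 2 * l2 - 2 * m1 ^+ 2 * m2) * m2
    - (h ^+ 2 * l1 * l2 ^+ 2 - 2 * m1 * m2 ^+ 2) * m1); first by rewrite /j; ring.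
  by rewrite F21 F12; ring.
(* Hence the matrix of the substitution is diagonal or antidiagonal; the squares below absorb the
   resulting sign of j^3. *)
rewrite !(expf_eq0, mulf_eq0) (negPf h0) (negPf two0) (negPf j0) !orbF /= => l12 m12.
have k0 : 2 * h != 0 by rewrite mulf_neq0.
suff: (h ^+ 5 * j ^+ 3) ^+ 2 = (e ^+ 2) ^+ 2.
  by rewrite -exprM => <-; rewrite exprMn -!exprM.
apply/eqP; rewrite eqf_sqr.
rewrite -(inj_eq (mulfI k0)) -[X in _ || X](inj_eq (mulfI k0)).
(* Without mixed terms, the discriminant is - 27 times the square of this product. *)
have prod := congr2 *%R F30 F03.
have [m10|m20] := orP m12; last first.
  have l10 : l1 == 0.
    case/orP: l12 => // l20; move: j0.
    by rewrite /j (eqP l20) (eqP m20) mul0r mulr0 subr0 eqxx.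
  apply/orP; right; apply/eqP; move: prod.
  by rewrite /j (eqP l10) (eqP m20) => E; ring: E.
have l20 : l2 == 0.
  case/orP: l12 => // l10; move: j0.
  by rewrite /j (eqP l10) (eqP m10) mul0r mulr0 subr0 eqxx.
apply/orP; left; apply/eqP; move: prod.
rewrite /j (eqP l20) (eqP m10) => E.
transitivity (- (e * (2 * h * 0 ^+ 3 - 1 ^+ 3) *
  (e * (2 * h * 1 ^+ 3 - 0 ^+ 3)))); last by ring.
by rewrite -[in RHS]E; ring.
Qed.

Variables (a e : K) (s : {rmorphism {polyXY K} -> {polyXY K}}).
Hypothesis ah : a = h + h.
Hypothesis sc : forall c, s (constXY c) = constXY c.
Hypothesis s_bij : bijective s.
Hypothesis sE : s (sextic h) = constXY e * quartic a.

Local Notation P := (s (varX K)).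
Local Notation Q := (s (varY K)).

Lemma sextic_image_line y0 v1 v2 :
  let u := line_res 0 y0 v1 v2 P in let w := line_res 0 y0 v1 v2 Q in
  let W := w ^+ 2 - u ^+ 3 - (h ^+ 2)%:P * w in
  let y : {poly K} := y0%:P + v2 *: 'X in
  W ^+ 2 - (h ^+ 4)%:P * W - (h ^+ 6)%:P * w =
  e%:P * (y ^+ 4 + a%:P * y ^+ 3 - (0%:P + v1 *: 'X) ^+ 3).
Proof.
have s_expr (c2 c4 c6 x y : {polyXY K}) :
    s ((y ^+ 2 - x ^+ 3 - c2 * y) ^+ 2
       - c4 * (y ^+ 2 - x ^+ 3 - c2 * y) - c6 * y) =
    (s y ^+ 2 - s x ^+ 3 - s c2 * s y) ^+ 2
       - s c4 * (s y ^+ 2 - s x ^+ 3 - s c2 * s y) - s c6 * s y.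
  by rewrite !(rmorphB, rmorphM, rmorphXn).
have := sE; rewrite /sextic s_expr !sc => /(congr1 (line_res 0 y0 v1 v2)).
rewrite /line_res /quartic; move: P Q => p q.
by rewrite !evXYE.
Qed.

(* The two cases are the D4 and the A2 critical point of f; the derivatives of P
   and Q at (0, y0) are (l1, l2) and (m1, m2). *)
Lemma sextic_image_jets (j y0 : K) :
    j != 0 -> jacobian P Q = constXY j -> y0 ^+ 3 *+ 4 + a * y0 ^+ 2 *+ 3 = 0 ->
  exists l1 l2 m1 m2, l1 * m2 - l2 * m1 = j /\
    ((e * (y0 ^+ 4 + a * y0 ^+ 3) = 0 /\
      forall v1 v2, - 2 * h ^+ 2 * (m1 * v1 + m2 * v2) ^+ 3
        + h ^+ 4 * (l1 * v1 + l2 * v2) ^+ 3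
        = e * ((y0 *+ 4 + a) * v2 ^+ 3 - v1 ^+ 3)) \/
     [/\ e * (y0 ^+ 4 + a * y0 ^+ 3) = - (27 / 16) * h ^+ 8,
         forall v1 v2, 9 / 2 * h ^+ 4 * (m1 * v1 + m2 * v2) ^+ 2
           = e * ((y0 ^+ 2 *+ 6 + a * y0 *+ 3) * v2 ^+ 2) &
         forall v1 v2, m1 * v1 + m2 * v2 = 0 ->
           - (1 / 2) * h ^+ 4 * (l1 * v1 + l2 * v2) ^+ 3
           = e * ((y0 *+ 4 + a) * v2 ^+ 3 - v1 ^+ 3)]).
Proof.
move=> j0 jE crit.
pose at_pt (r : {polyXY K}) := r.[y0%:P].[0].
set l1 := at_pt (map_poly (@deriv K) P); set l2 := at_pt P^`().
set m1 := at_pt (map_poly (@deriv K) Q); set m2 := at_pt Q^`().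
have jlm : l1 * m2 - l2 * m1 = j.
  have := congr1 at_pt jE.
  by rewrite /at_pt /jacobian /constXY !hornerE => <-.
exists l1, l2, m1, m2; split=> //.
have eqs v1 v2 : exists u w : {poly K},
    [/\ [/\ u`_0 = at_pt P, u`_1 = l1 * v1 + l2 * v2, w`_0 = at_pt Q
      & w`_1 = m1 * v1 + m2 * v2] &
    let W := w ^+ 2 - u ^+ 3 - (h ^+ 2)%:P * w in
    let y : {poly K} := y0%:P + v2 *: 'X in
    W ^+ 2 - (h ^+ 4)%:P * W - (h ^+ 6)%:P * w =
    e%:P * (y ^+ 4 + a%:P * y ^+ 3 - (0%:P + v1 *: 'X) ^+ 3)].
  exists (line_res 0 y0 v1 v2 P), (line_res 0 y0 v1 v2 Q).
  by split; [rewrite !line_res0 !line_res1 | exact: sextic_image_line].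
(* By [crit] the point (0, y0) is critical for g, so its image is critical for f. *)
have [] := @sextic_critical_point (at_pt P) (at_pt Q) l1 l2 m1 m2.
- by rewrite jlm.
- move=> v1 v2; have [u [w [[u0 u1 w0 w1] /= E]]] := eqs v1 v2.
  have /= [_ + _ _] := sextic_low_coefs h u w.
  have /= [_ + _ _] := quartic_low_coefs a y0 v1 v2.
  rewrite E coefCM => ->; rewrite crit mul0r mulr0.
  by rewrite u0 u1 w0 w1 => ->.
move=> P0 Q0.
have {}eqs v1 v2 : exists u w : {poly K},
    [/\ u`_0 = 0, u`_1 = l1 * v1 + l2 * v2, w`_0 = at_pt Q
      & w`_1 = m1 * v1 + m2 * v2] /\
    let F := (w ^+ 2 - u ^+ 3 - (h ^+ 2)%:P * w) ^+ 2
      - (h ^+ 4)%:P * (w ^+ 2 - u ^+ 3 - (h ^+ 2)%:P * w)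
      - (h ^+ 6)%:P * w in
    [/\ e * (y0 ^+ 4 + a * y0 ^+ 3) = F`_0,
        e * ((y0 ^+ 2 *+ 6 + a * y0 *+ 3) * v2 ^+ 2) = F`_2 &
        e * ((y0 *+ 4 + a) * v2 ^+ 3 - v1 ^+ 3) = F`_3].
  have [u [w [uw /= E]]] := eqs v1 v2; exists u, w; rewrite P0 in uw; split=> //=.
  have /= [<- _ <- <-] := quartic_low_coefs a y0 v1 v2.
  by rewrite E !coefCM.
case: Q0 => Q0; [left | right]; split.
- have [u [w [[u0 u1 w0 w1] /= [-> _ _]]]] := eqs 0 0.
  have /= [-> _ _ _] := sextic_low_coefs h u w; rewrite u0 w0 Q0; ring.
- move=> v1 v2; have [u [w [[u0 u1 w0 w1] /= [_ _ ->]]]] := eqs v1 v2.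
  have /= [_ _ _ ->] := sextic_low_coefs h u w; rewrite u0 u1 w0 w1 Q0; ring.
- have [u [w [[u0 u1 w0 w1] /= [-> _ _]]]] := eqs 0 0.
  have /= [-> _ _ _] := sextic_low_coefs h u w; rewrite u0 w0 Q0; field.
  by rewrite sixteen0 two0.
- move=> v1 v2; have [u [w [[u0 u1 w0 w1] /= [_ -> _]]]] := eqs v1 v2.
  have /= [_ _ -> _] := sextic_low_coefs h u w; rewrite u0 u1 w0 w1 Q0; field.
  exact: two0.
(* On the kernel of the quadratic form, the second-order terms of u and w drop out of the cubic
   coefficient. *)
- move=> v1 v2 mv; have [u [w [[u0 u1 w0 w1] /= [_ _ ->]]]] := eqs v1 v2.
  have /= [_ _ _ ->] := sextic_low_coefs h u w.
  rewrite u0 u1 w0 w1 mv Q0; field.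
  exact: two0.
Qed.

Lemma sextic_image_quartic_absurd : False.
Proof.
have [j j0 jE] := jacobian_automorphism sc s_bij.
have h80 n : h ^+ n != 0 by rewrite expf_neq0.
have nine0 : 9 != 0 :> K by rewrite (_ : 9 = 3 * 3) ?mulf_neq0 //; ring.
have c27 : - (27 / 16) != 0 :> K.
  rewrite oppr_eq0 mulf_neq0 ?invr_neq0 //.
  by rewrite (_ : 27 = 3 * 9) ?mulf_neq0 //; ring.
have jE6 : h ^+ 10 * j ^+ 6 = e ^+ 4.
  (* At the origin g has critical value 0, which rules out the A2 alternative. *)
  have [|l1 [l2 [m1 [m2 [jlm]]]]] := @sextic_image_jets j 0 j0 jE.
    by ring.
  case=> [[_ F3]|[/eqP + _ _]]; last first.
    rewrite !expr0n !mulr0 addr0 mulr0 eq_sym mulf_eq0.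
    by rewrite (negPf c27) (negPf (h80 _)).
  rewrite -jlm; apply: D4_invariant => [|v1 v2]; first by rewrite jlm.
  by rewrite F3 ah; ring.
have e0 : e != 0.
  apply/eqP => e0; move: jE6; rewrite e0 expr0n => /eqP.
  by rewrite mulf_eq0 !expf_eq0 (negPf h0) (negPf j0).
(* The other root of 4 y^3 + 3 a y^2 is - 3a/4; its nonzero critical value rules out D4. *)
have [|l1 [l2 [m1 [m2 [jlm]]]]] := @sextic_image_jets j (- (3 / 2) * h) j0 jE.
  by rewrite ah; field; rewrite ?sixteen0 ?two0.
have q0 : (- (3 / 2) * h) ^+ 4 + a * (- (3 / 2) * h) ^+ 3 = - (27 / 16) * h ^+ 4.
  by rewrite ah; field; rewrite ?sixteen0 ?two0.
rewrite q0; case=> [[/eqP + _]|[eE F2 F3]].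
  by rewrite mulf_eq0 (negPf e0) mulf_eq0 (negPf c27) (negPf (h80 _)).
have {}eE : e = h ^+ 4.
  apply: (mulIf (h80 4%N)); apply: (mulfI c27); rewrite mulrCA eE; ring.
have c9 : 9 / 2 * h ^+ 4 != 0 by rewrite !mulf_neq0 ?invr_neq0 ?expf_neq0.
(* The quadratic forms give m1 = 0 and m2^2 = h^2; then (1, 0) is the kernel direction, and the
   cubic terms there give l1^3 = 2. *)
have m10 : m1 = 0.
  have /eqP := F2 1 0; rewrite expr0n !mulr0 addr0 mulr1 mulf_eq0 (negPf c9).
  by rewrite expf_eq0 => /eqP.
have m2E : m2 ^+ 2 = h ^+ 2.
  have := F2 0 1; rewrite m10 mul0r add0r mulr1 eE ah => E.
  by apply: (mulfI c9); rewrite E; field.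
have l1E : l1 ^+ 3 = 2.
  have := F3 1 0; rewrite m10 mulr1 mulr0 addr0 !mulr1 mulr0 addr0 eE => E.
  apply: (mulfI (h80 4%N)).
  have -> : h ^+ 4 * l1 ^+ 3 = - 2 * (- (1 / 2) * h ^+ 4 * l1 ^+ 3) by field.
  by rewrite (E erefl); ring.
have j6 : j ^+ 6 = 4 * h ^+ 6.
  rewrite -jlm m10 mulr0 subr0 exprMn (exprM _ 3 2) l1E (exprM _ 2 3) m2E.
  by ring.
have /eqP : 3 * h ^+ 16 = 0.
  transitivity (h ^+ 10 * j ^+ 6 - e ^+ 4); last by rewrite jE6 subrr.
  by rewrite j6 eE; ring.
by rewrite mulf_eq0 (negPf three0) (negPf (h80 _)).
Qed.

End Invariants.

(** * The expanded equation of f, and the conclusion *)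

Lemma sexticE (K : fieldType) (a h : K) : 2 != 0 :> K -> a = h + h ->
  let x := varX K in let y := varY K in let c := @constXY K in
  sextic h = y ^+ 4 - c 2 * x ^+ 3 * y ^+ 2 + x ^+ 6
    - c (2^-1 * a ^+ 2) * y ^+ 3
    + c (2^-1 * a ^+ 2) * x ^+ 3 * y
    + c (16^-1 * a ^+ 4) * x ^+ 3.
Proof.
move=> two0 ah x y c.
have sixteen0 : 16 != 0 :> K.
  by rewrite (_ : 16 = (2 * 2) * (2 * 2)) ?mulf_neq0 //; ring.
have -> : 2^-1 * a ^+ 2 = 2 * h ^+ 2 by rewrite ah; field.
have -> : 16^-1 * a ^+ 4 = h ^+ 4 by rewrite ah; field; rewrite sixteen0.
rewrite /sextic /wXY -/x -/y /c /constXY !(polyCM, polyC_exp) !rmorph_nat.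
by ring.
Qed.

Theorem mainTheorem2 (K : closedFieldType) (hK : [pchar K] =i pred0)
    (a : K) (ha : a != 0) :
  [/\ xt a = 'X^4 - a *: 'X,
      exists! f, y_monic_kernel_generator (xt a) (yt a) f,
      exists! g, y_monic_kernel_generator (xt a) (zt a) g &
      forall f g : {polyXY K},
        y_monic_kernel_generator (xt a) (yt a) f ->
        y_monic_kernel_generator (xt a) (zt a) g ->
        let x := varX K in let y := varY K in let c := @constXY K in
        (forall p, in_subalg (xt a) (yt a) p <-> in_subalg (xt a) (zt a) p) /\
        [/\ f = y ^+ 4 - c 2 * x ^+ 3 * y ^+ 2 + x ^+ 6
                - c (2^-1 * a ^+ 2) * y ^+ 3
                + c (2^-1 * a ^+ 2) * x ^+ 3 * y
                + c (16^-1 * a ^+ 4) * x ^+ 3,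
            g = y ^+ 4 + c a * y ^+ 3 - x ^+ 3,
            isomorphic f g,
            ~ equivalent f g &
            polynomial_curve f /\ has_inequivalent_embeddings f]].
Proof.
have nat0 n : n.+1%:R != 0 :> K by move/pcharf0P: hK => ->.
pose h := a / 2; have ah : a = h + h by rewrite /h; field; exact: nat0.
have h0 : h != 0 by rewrite mulf_neq0 ?invr_neq0 ?nat0.
have sexticP : y_monic_kernel_generator (xt a) (yt a) (sextic h).
  by split; [exact: sextic_monic | exact: sextic_kernel].
have quarticP : y_monic_kernel_generator (xt a) (zt a) (quartic a).
  by split; [exact: quartic_monic | exact: quartic_kernel].
split.
- by rewrite /xt /zt mulrBr -exprS mulrC mul_polyC.
- by exists (sextic h); split=> // f; apply: y_monic_kernel_generator_uniq.
- by exists (quartic a); split=> // g; apply: y_monic_kernel_generator_uniq.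
move=> f g fP gP x y c.
rewrite (y_monic_kernel_generator_uniq fP sexticP).
rewrite (y_monic_kernel_generator_uniq gP quarticP) => {f g fP gP}.
split=> [p|].
  split=> -[q ->].
    by exists (q \Po to_z h); exact: evXY_comp_to_z.
  by exists (q \Po to_y h); exact: evXY_comp_to_y.
(* Equality of ideals provides the constant factor e, so the curves themselves are inequivalent. *)
have inequiv : ~ equivalent_curves (sextic h) (quartic a).
  move=> [k /eq_pideal_const[e _ kE] [s [sc s_bij ks]]].
  exact: (sextic_image_quartic_absurd h0 (nat0 1%N) (nat0 2%N) ah sc s_bij
    (etrans (esym ks) kE)).
have iso_fg : isomorphic (sextic h) (quartic a).
  exact: sextic_quartic_isomorphic ah h0.
split=> //.
- exact: sexticE (nat0 1) ah.
- by move=> fg; apply: inequiv; exists (quartic a).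
split; first by exists (xt a), (yt a); case: sexticP.
(* The two embeddings are the curve f itself and g. *)
exists (sextic h), (quartic a); split=> //.
case: sexticP => _ fker.
exact: (@isomorphic_of_substitution _ _ _ _ _ _ _ idfun idfun fker fker).
Qed.
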